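(* Consider the linear regression model described in the context (in which $p_n$ may exceed $n$). Let $0<\gamma<1$, and let $\widetilde{\boldsymbol{\beta}}_n=(\widetilde{\boldsymbol{\beta}}_{n1}',\widetilde{\boldsymbol{\beta}}_{n2}')'$ (with $\widetilde{\boldsymbol{\beta}}_{n1}\in\mathbb{R}^{k_n}$, $\widetilde{\boldsymbol{\beta}}_{n2}\in\mathbb{R}^{m_n}$) be the minimizer over $\boldsymbol{\beta}\in\mathbb{R}^{p_n}$ of the marginal bridge objective function $$U_n(\boldsymbol{\beta})=\sum_{j=1}^{p_n}\sum_{i=1}^n (Y_i-x_{ij}\beta_j)^2+\lambda_n\sum_{j=1}^{p_n}|\beta_j|^\gamma .$$ Suppose that: 1. $\varepsilon_1,\varepsilon_2,\ldots$ are independent and identically distributed random variables with mean zero and variance $\sigma^2$, $0<\sigma^2<\infty$, and they are sub-Gaussian: there are constants $C,K>0$ such that $P(|\varepsilon_i|>x)\le K\exp(-Cx^2)$ for all $x>0$, $i=1,2,\ldots$; 2. (partial orthogonality) there exists a constant $c_0>0$ such that $\left|n^{-1/2}\sum_{i=1}^n x_{ij}x_{ik}\right|\le c_0$ for all $j\in J_n$, $k\in K_n$, for all $n$ sufficiently large; and there exists a constant $\xi_0>0$ such that $\min_{k\in K_n}|\xi_{nk}|>\xi_0$; 3. $\lambda_n/n\to 0$, $\lambda_n n^{-\gamma/2}k_n^{\gamma-2}\to\infty$, and $\log(m_n)=o(1)\,(\lambda_n n^{-\gamma/2})^{2/(2-\gamma)}$; 4. there exists a constant $0<b_1<\infty$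 such that $\max_{k\in K_n}|\beta_{10,k}|\le b_1$, where $\beta_{10,k}$ is the $k$th component of $\boldsymbol{\beta}_{10}$. Then, as $n\to\infty$, $$P(\widetilde{\boldsymbol{\beta}}_{n2}=\mathbf{0})\to 1\quad\text{and}\quad P(\widetilde{\beta}_{n1k}\ne 0 \text{ for all } k\in K_n)\to 1,$$ where $\widetilde{\beta}_{n1k}$ is the $k$th component of $\widetilde{\boldsymbol{\beta}}_{n1}$.
   Context: For each sample size $n$, the model is $Y_i=\mathbf{x}_i'\boldsymbol{\beta}_0+\varepsilon_i$, $i=1,\ldots,n$, where $\mathbf{x}_i=(x_{i1},\ldots,x_{ip_n})'\in\mathbb{R}^{p_n}$ are fixed (nonrandom) covariate vectors and $\boldsymbol{\beta}_0\in\mathbb{R}^{p_n}$ is the true parameter; $p_n$, $\mathbf{x}_i$ and $\boldsymbol{\beta}_0$ may depend on $n$. The covariates are standardized: $\sum_{i=1}^n x_{ij}=0$ and $n^{-1}\sum_{i=1}^n x_{ij}^2=1$ for $j=1,\ldots,p_n$. The true parameter is partitioned as $\boldsymbol{\beta}_0=(\boldsymbol{\beta}_{10}',\boldsymbol{\beta}_{20}')'$, where $\boldsymbol{\beta}_{10}$ is the $k_n\times 1$ vector of nonzero coefficients and $\boldsymbol{\beta}_{20}=\mathbf{0}$ is an $m_n\times 1$ vector, $p_n=k_n+m_n$. Correspondingly $\mathbf{x}_i=(\mathbf{w}_i',\mathbf{z}_i')'$ with $\mathbf{w}_i\in\mathbb{R}^{k_n}$, $\mathbf{z}_i\in\mathbb{R}^{m_n}$.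 $K_n=\{1,\ldots,k_n\}$ and $J_n=\{k_n+1,\ldots,p_n\}$ are the index sets of nonzero and zero coefficients. $\lambda_n\ge 0$ is a deterministic penalty parameter. Define $\xi_{nj}=n^{-1}\mathrm{E}\left(\sum_{i=1}^n Y_i x_{ij}\right)=n^{-1}\sum_{i=1}^n(\mathbf{w}_i'\boldsymbol{\beta}_{10})x_{ij}$. All constants are independent of $n$. *)

(* Defs.v *)
From HB Require Import structures.
From mathcomp Require Export all_boot all_order all_algebra.
From mathcomp Require Export finmap.
From mathcomp Require Export all_classical all_reals all_analysis.
Export Order.TTheory GRing.Theory Num.Theory.
Export numFieldNormedType.Exports.

Set Implicit Arguments.
Unset Strict Implicit.
Unset Printing Implicit Defensive.

Local Open Scope classical_set_scope.
Local Open Scope ring_scope.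

Section random_variables.
Context (d : measure_display) (T : measurableType d) (R : realType).
Context (P : probability T R).
Implicit Type X : nat -> {RV P >-> R}.

Definition mutually_independent X : Prop :=
  forall (J : {fset nat}) (B : nat -> set R), (forall i, measurable (B i)) ->
  P (\bigcap_(i in [set` J]) (X i @^-1` B i)) =
  (\prod_(i <- J) P (X i @^-1` B i))%E.

(* Equality is required on Borel sets only: the library's [distribution] is a
   total function on sets, unconstrained outside the measurable ones. *)
Definition identically_distributed X : Prop :=
  forall (i j : nat) (B : set R), measurable B ->
  distribution P (X i) B = distribution P (X j) B.

Definition sub_gaussian X : Prop :=
  exists C K : R, [/\ 0 < C, 0 < K &
    forall (i : nat) (x : R), 0 < x ->
      (P [set w | (x < `|X i w|)%R] <= (K * expR (- C * x ^+ 2))%:E)%E].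

End random_variables.

(* The model at one sample size n, with k nonzero and m zero coefficients. Row i
   of [x] is the covariate vector x_i'; the columns [lshift m _] and
   [rshift k _] are those of w_i and z_i, so they enumerate K_n and J_n. *)
Section model.
Context (R : realType) (n k m : nat).
Implicit Types (x : 'M[R]_(n, k + m)) (b : 'cV[R]_k).

Definition standardized x : Prop :=
  forall j, \sum_i x i j = 0 /\ n%:R^-1 * \sum_i x i j ^+ 2 = 1.

Definition true_parameter b : 'cV[R]_(k + m) := col_mx b 0.

(* The errors are numbered from 0: [eps i] is the error of observation i + 1. *)
Definition response (T : Type) x b (eps : nat -> T -> R) (i : 'I_n)
    (w : T) : R :=
  (x *m true_parameter b) i 0 + eps i w.

Definition bridge_objective x (y : 'I_n -> R) (lambda gamma : R)
    (beta : 'cV[R]_(k + m)) : R :=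
  \sum_j \sum_i (y i - x i j * beta j 0) ^+ 2
  + lambda * \sum_j `|beta j 0| `^ gamma.

Definition xi (d : measure_display) (T : measurableType d)
    (P : probability T R) x b (eps : nat -> {RV P >-> R})
    (j : 'I_(k + m)) : R :=
  n%:R^-1 *
  fine ('E_P[fun w => (\sum_i response x b eps i w * x i j)%R])%E.

End model.

(* Main.v *)
Require Import Defs.
From mathcomp Require Import measurable_realfun ring lra.

(** The objective function is separable: since each column of the design has
mean square 1, the terms of coordinate [j] are, up to a constant,
n b^2 - 2 S_j b + lambda |b|^gamma with S_j = sum_i Y_i x_ij, so a minimizer
minimizes each of these scalar functions. The concave penalty makes such a
function a thresholding rule for S_j. Let t be the solution of
lambda = n t^(2 - gamma), i.e. t = h / sqrt n with
h = (lambda n^(-gamma/2))^(1/(2 - gamma)). If |S_j| <= n t / 2 then the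
minimizer is 0 ([bridge_coordinate_eq0]); if |S_j| / n is larger than t then
the value at b = S_j / n is negative and the minimizer is not 0
([bridge_coordinate_neq0]).

Now S_j = n xi_j + sum_i x_ij eps_i. For a zero coefficient, partial
orthogonality gives |n xi_j| <= b1 c0 k_n sqrt n, which the growth condition
k_n = o(h) makes negligible against sqrt n h; the coefficient can only be
missed if the noise exceeds a multiple of sqrt n h. For a nonzero coefficient,
|n xi_j| > n xi0 while n t = o(n), and the noise must exceed a multiple of n.
The noise is a weighted sum of independent centred sub-Gaussian variables
with squared weights of total n, so it exceeds u with probability at most
2 exp(- u^2 / (4 c n)) ([weighted_sum_tail]). Union bounds over the m_n zero
and the k_n nonzero coefficients leave 2 m_n exp(- C h^2), which vanishes since
log m_n = o(h^2) and h tends to infinity, and 2 k_n exp(- C n), which vanishes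
since k_n <= h <= sqrt n eventually.

The exponential tail bound is Chernoff's, and needs two facts. Independence of
events has to be transferred to expectations of products of functions
([ge0_integral_prod_indep]); and a tail K exp(- C x^2) has to be turned into
E exp(t eps) <= exp(c t^2) for all real t, which goes through a bound on
E exp(s eps^2) ([expR_sqr_moment_le], [mgf_le_of_expR_sqr]). *)

Set Implicit Arguments.
Unset Strict Implicit.
Unset Printing Implicit Defensive.

Import HBNNSimple.

Local Open Scope classical_set_scope.
Local Open Scope ring_scope.

(** * Expectations of products of independent variables *)

(** Both sides are additive in [f], and monotone convergence extends the
identity from indicators to simple functions and then to [f]. Finiteness of
the expectation of [Z] lets the last limit pass through the product. *)
Lemma ge0_integral_mul_indep d (T : measurableType d) (R : realType)
    (P : probability T R) (X : {RV P >-> R}) (Z : T -> R) (f : R -> R) :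
  measurable_fun [set: T] Z -> (forall w, 0 <= Z w) ->
  measurable_fun [set: R] f -> (forall y, 0 <= f y) ->
  (\int[P]_w (Z w)%:E)%E \is a fin_num ->
  (forall B, measurable B ->
     (\int[P]_w (\1_B (X w) * Z w)%:E = P (X @^-1` B) * \int[P]_w (Z w)%:E)%E) ->
  (\int[P]_w (f (X w) * Z w)%:E =
   \int[P]_w (f (X w))%:E * \int[P]_w (Z w)%:E)%E.
Proof.
move=> mZ Z0 mf f0 Zfin XZ.
have mX : measurable_fun [set: T] X by [].
have mfE := mf; move/measurable_EFinP : mfE => mfE.
pose g := nnsfun_approx measurableT mfE.
have gf y : (g n y)%:E @[n --> \oo] --> (f y)%:E.
  apply: (@cvg_nnsfun_approx _ _ _ _ measurableT _ mfE) => //= z _.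
  by rewrite lee_fin.
have gnd : nondecreasing_seq (g : (R -> R)^nat) by exact: nd_nnsfun_approx.
have mgX n : measurable_fun [set: T] (fun w => g n (X w)).
  by apply: (measurableT_comp (f := g n)).
have simple n : (\int[P]_w (g n (X w) * Z w)%:E =
    \int[P]_w (g n (X w))%:E * \int[P]_w (Z w)%:E)%E.
  pose A y := g n @^-1` [set y].
  have mA y : measurable (A y) by exact: measurable_funPTI.
  (* the value y of g n is nonnegative; Num.max y 0 records this for all y *)
  have expand (V : T -> R) : measurable_fun [set: T] V -> (forall w, 0 <= V w) ->
      (\int[P]_w (g n (X w) * V w)%:E = \sum_(y \in range (g n))
        ((Num.max y 0)%:E * \int[P]_w (\1_(A y) (X w) * V w)%:E))%E.
    move=> mV V0.
    have m1 y : measurable_fun [set: T] (fun w => \1_(A y) (X w) * V w).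
      apply: measurable_funM => //.
      by apply: (measurableT_comp _ mX); exact: measurable_indic.
    transitivity (\int[P]_w (\sum_(y \in range (g n))
        ((Num.max y 0)%:E * (\1_(A y) (X w) * V w)%:E)))%E.
      apply: eq_integral => w _.
      under eq_fsbigr do rewrite -EFinM.
      rewrite fsumEFin; last exact: fimfunP.
      congr EFin; rewrite (fimfunE (g n)) mulr_fsuml; apply: eq_fsbigr => y.
      rewrite inE => -[z _ <-]; rewrite mulrA; congr (_ * _ * _).
      by rewrite max_l.
    rewrite ge0_integral_fsum//.
    - apply: eq_fsbigr => y _; rewrite ge0_integralZl_EFin//.
      + by move=> w _; rewrite lee_fin mulr_ge0.
      + exact/measurable_EFinP.
      + by rewrite le_max lexx orbT.
    - by move=> y; apply: measurable_funeM; exact/measurable_EFinP.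
    - move=> y w _; rewrite mule_ge0// lee_fin ?mulr_ge0//.
      by rewrite le_max lexx orbT.
  rewrite expand//.
  have -> : (\int[P]_w (g n (X w))%:E = \int[P]_w (g n (X w) * cst 1 w)%:E)%E.
    by apply: eq_integral => w _; rewrite mulr1.
  rewrite expand// ge0_mule_fsuml => [|y]; last first.
    rewrite mule_ge0 ?lee_fin ?le_max ?lexx ?orbT//.
    by apply: integral_ge0 => w _; rewrite lee_fin mulr_ge0.
  apply: eq_fsbigr => y _; rewrite XZ// -muleA; congr (_ * (_ * _))%E.
  under eq_integral do rewrite mulr1.
  rewrite (eq_integral (fun w => (\1_(X @^-1` A y) w)%:E))//.
  rewrite integral_indic ?setIT//.
  by rewrite -[X in measurable X]setTI; exact: mX.
have lim (V : T -> R) : measurable_fun [set: T] V -> (forall w, 0 <= V w) ->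
    ((\int[P]_w (g n (X w) * V w)%:E)%E @[n --> \oo] -->
      (\int[P]_w (f (X w) * V w)%:E)%E).
  move=> mV V0.
  have -> : (\int[P]_w (f (X w) * V w)%:E =
      \int[P]_w (limn (fun n => (g n (X w) * V w)%:E)))%E.
    apply: eq_integral => w _; apply/esym/cvg_lim => //.
    rewrite EFinM; under eq_fun do rewrite EFinM.
    by apply: cvgeZr => //; exact: gf.
  apply: cvg_monotone_convergence => //.
  - by move=> n; apply/measurable_EFinP; exact: measurable_funM.
  - by move=> n w _; rewrite lee_fin mulr_ge0.
  - move=> w _ n m nm; rewrite lee_fin ler_wpM2r//.
    by have /lefP := gnd _ _ nm; apply.
have l1 := lim _ mZ Z0.
rewrite (funext simple) in l1.
have l2 : (\int[P]_w (g n (X w))%:E)%E @[n --> \oo] --> (\int[P]_w (f (X w))%:E)%E.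
  have := lim (cst 1) (measurable_cst _) (fun=> ler01).
  under eq_fun do under eq_integral do rewrite mulr1.
  by under [X in _ --> X -> _]eq_integral do rewrite mulr1.
have l3 : (\int[P]_w (g n (X w))%:E * \int[P]_w (Z w)%:E)%E @[n --> \oo] -->
    (\int[P]_w (f (X w))%:E * \int[P]_w (Z w)%:E)%E by exact: cvgeZr.
exact: (cvg_unique _ l1 l3).
Qed.

Lemma probability_bigcap_indep d (T : measurableType d) (R : realType)
    (P : probability T R) (X : nat -> {RV P >-> R}) (n : nat) (B : nat -> set R) :
  mutually_independent X -> (forall i, measurable (B i)) ->
  (P (\bigcap_(i < n) (X i @^-1` B i)) = \prod_(i < n) P (X i @^-1` B i))%E.
Proof.
move=> indep mB; pose J := [fset i | i in iota 0 n]%fset.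
have JE i : (i \in J) = (i < n)%N by rewrite in_fset /= mem_iota add0n.
have := indep J B mB.
rewrite (_ : [set` J] = `I_n); last by apply/seteqP; split => i /=; rewrite JE.
move=> ->; rewrite -(big_mkord xpredT (fun i => P (X i @^-1` B i))).
apply: perm_big; apply: uniq_perm; rewrite ?fset_uniq ?iota_uniq// => i.
by rewrite JE mem_index_iota.
Qed.

(** The independence hypothesis is the case where every [f i] is an indicator.
General functions are put in place of the indicators one factor at a time: at
stage [l] only the factors of index at least [l] must be indicators, and
[ge0_integral_mul_indep], applied to factor [l] and the product of the others,
frees that factor. *)
Lemma ge0_integral_prod_indep d (T : measurableType d) (R : realType)
    (P : probability T R) (X : nat -> {RV P >-> R}) (n : nat) (f : nat -> R -> R) :
  mutually_independent X ->
  (forall i, measurable_fun [set: R] (f i)) -> (forall i y, 0 <= f i y) ->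
  (forall i, (\int[P]_w (f i (X i w))%:E)%E \is a fin_num) ->
  (\int[P]_w (\prod_(i < n) f i (X i w))%:E =
   \prod_(i < n) \int[P]_w (f i (X i w))%:E)%E.
Proof.
move=> indep.
suff H l : (l <= n)%N -> forall f : nat -> R -> R,
    (forall i, measurable_fun [set: R] (f i)) -> (forall i y, 0 <= f i y) ->
    (forall i, (\int[P]_w (f i (X i w))%:E)%E \is a fin_num) ->
    (forall i, (l <= i < n)%N -> exists2 B, measurable B & f i = \1_B) ->
    (\int[P]_w (\prod_(i < n) f i (X i w))%:E =
     \prod_(i < n) \int[P]_w (f i (X i w))%:E)%E.
  by move=> mf f0 ffin; apply: (H n) => // i; case: ltnP; rewrite ?andbF.
elim: l => [_|l IH ln] {}f mf f0 ffin find.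
  have /choice[B BE] : forall i, exists B : set R, measurable B /\ ((i < n)%N -> f i = \1_B).
    move=> i; case: (ltnP i n) => ni; last by exists setT; split.
    by have [B mB fB] := find i ni; exists B.
  have mB i : measurable (B i) by case: (BE i).
  have mXB i : measurable (X i @^-1` B i) by exact: measurable_funPTI.
  transitivity (P (\bigcap_(i < n) (X i @^-1` B i))).
    rewrite -[X in P X]setIT -integral_indic//; last exact: bigcap_measurableType.
    apply: eq_integral => w _; congr EFin.
    rewrite (eq_bigr (fun i : 'I_n => \1_(X i @^-1` B i) w : R)); last first.
      by move=> i _; rewrite (BE i).2.
    rewrite indicE; case: (boolP (w \in _)) => [|]; rewrite ?inE ?notin_setE.
      by move=> wB; rewrite big1// => i _; rewrite indicE mem_set//; apply: wB => /=.
    move=> wB; apply/eqP; rewrite prodf_seq_eq0; apply/hasP.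
    apply: contrapT => nB; apply: wB => i /= ni; apply: contrapT => nBi; apply: nB.
    exists (Ordinal ni); first by rewrite mem_index_enum.
    by rewrite /= indicE memNset.
  rewrite probability_bigcap_indep//; apply: eq_bigr => i _.
  rewrite (BE i).2//.
  rewrite (eq_integral (fun w => (\1_(X i @^-1` B i) w)%:E))//.
  by rewrite integral_indic ?setIT.
have mX i : measurable_fun [set: T] (X i) by [].
pose lo := Ordinal ln.
pose F h i := if i == l then h else f i.
pose Z w := \prod_(i < n | i != lo) f i (X i w).
pose c := (\prod_(i < n | i != lo) \int[P]_w (f i (X i w))%:E)%E.
have FZ h w : \prod_(i < n) F h i (X i w) = h (X l w) * Z w.
  rewrite (bigD1 lo)//= /F eqxx; congr (_ * _); apply: eq_bigr => i il.
  by rewrite -val_eqE /= in il; rewrite (negbTE il).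
have mZ : measurable_fun [set: T] Z.
  rewrite (_ : Z = fun w =>
      \prod_(i <- index_enum 'I_n) (if i != lo then f i (X i w) else 1)); last first.
    by apply/funext => w; rewrite /Z big_mkcond.
  apply: measurable_prod => i _; case: (i != lo) => //.
  by apply: (measurableT_comp (mf i) (mX i)).
have Z0 w : 0 <= Z w by exact: prodr_ge0.
have XZ B : measurable B -> (\int[P]_w (\1_B (X l w) * Z w)%:E = P (X l @^-1` B) * c)%E.
  move=> mB.
  have mXB : measurable (X l @^-1` B) by exact: measurable_funPTI.
  have EB : (\int[P]_w (\1_B (X l w))%:E = P (X l @^-1` B))%E.
    rewrite (eq_integral (fun w => (\1_(X l @^-1` B) w)%:E))//.
    by rewrite integral_indic ?setIT.
  have := IH (ltnW ln) (F \1_B); under eq_integral do rewrite FZ.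
  move=> ->.
  - rewrite (bigD1 lo)//= {1}/F eqxx EB; congr (_ * _)%E; apply: eq_bigr => i il.
    by rewrite -val_eqE /= in il; rewrite /F (negbTE il).
  - move=> i; rewrite /F; case: ifP => _ //; exact: measurable_indic.
  - by move=> i y; rewrite /F; case: ifP.
  - move=> i; rewrite /F; case: ifP => // /eqP ->; rewrite EB.
    exact: fin_num_measure.
  - move=> i /andP[li ni]; rewrite /F; case: eqVneq => [_|il]; first by exists B.
    by apply: find; rewrite ni andbT ltn_neqAle eq_sym il.
have Zc : (\int[P]_w (Z w)%:E = c)%E.
  have := XZ setT measurableT; rewrite preimage_setT probability_setT mul1e => <-.
  by apply: eq_integral => w _; rewrite indicE in_setT mul1r.
transitivity (\int[P]_w (f l (X l w) * Z w)%:E)%E.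
  by apply: eq_integral => w _; rewrite (bigD1 lo).
rewrite (ge0_integral_mul_indep mZ Z0 (mf l) (f0 l)) ?Zc//.
- by rewrite (bigD1 lo).
- by apply: prode_fin_num.
Qed.

(** * From Gaussian tails to moment generating functions *)

(** Replaces the second-order Taylor bound of a centred moment generating
function: in expectation the linear term vanishes, which leaves only the
exponential of a square. *)
Lemma expR_le_addr_expR_sqr (R : realType) (x : R) : expR x <= x + expR (2 * x ^+ 2).
Proof.
have e0 := expR_gt0 x; have eN := expR_ge1Dx (- x).
have e2 := expR_ge1Dx (2 * x ^+ 2).
have ee : expR x * expR (- x) = 1 by rewrite -expRD subrr expR0.
have [x0|x0] := leP x 0.
  suff : expR x <= 1 + x + x ^+ 2 by nra.
  nra.
have [x1|x1] := leP x (1 / 2); last first.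
  have : expR x <= expR (2 * x ^+ 2) by rewrite ler_expR; nra.
  by nra.
suff : expR x <= 1 + x + 2 * x ^+ 2 by nra.
have h : expR x * (1 - x) <= 1 by nra.
have h2 : 1 <= (1 + x + 2 * x ^+ 2) * (1 - x).
  have : 0 <= x ^+ 2 * (1 - 2 * x) by rewrite mulr_ge0 ?sqr_ge0//; lra.
  by lra.
have h3 : 0 < 1 - x by lra.
rewrite -(ler_pM2r h3); lra.
Qed.

(** With s = C / 4, the integrand is at most exp(s (n + 1)) on
n <= X^2 < n + 1, and the tail bound at sqrt (n / 2) gives
P (X^2 >= n) <= (K + 1) exp(- 2 s n); a geometric series of ratio exp(- s)
remains. The tail hypothesis is strict, hence a radius below sqrt n, and the
summand 1 in K + 1 covers n = 0. *)
Lemma expR_sqr_moment_le d (T : measurableType d) (R : realType)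
    (P : probability T R) (X : {RV P >-> R}) (C K : R) : 0 < C -> 0 < K ->
  (forall x : R, (0 < x)%R -> P [set w | (x < `|X w|)%R] <= (K * expR (- C * x ^+ 2))%:E)%E ->
  (\int[P]_w (expR (C / 4 * X w ^+ 2))%:E <=
    ((K + 1) * expR (C / 4) / (1 - expR (- (C / 4))))%:E)%E.
Proof.
move=> C0 K0 tailX; set s := C / 4.
have s0 : 0 < s by rewrite divr_gt0.
have mX2 : measurable_fun [set: T] (fun w => X w ^+ 2) by exact: measurable_funX.
pose A (n : nat) := [set w | n%:R <= X w ^+ 2].
have mA n : measurable (A n).
  rewrite -[A n]setTI (_ : A n = (fun w => X w ^+ 2) @^-1` `[n%:R, +oo[); first exact: mX2.
  by apply/seteqP; split => w; rewrite /A /= in_itv /= andbT.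
have PA n : (P (A n) <= ((K + 1) * expR (- (2 * s * n%:R)))%:E)%E.
  case: n => [|n].
    rewrite mulr0 oppr0 expR0 mulr1 (le_trans (probability_le1 _ _))//.
    by rewrite lee_fin lerDr ltW.
  pose r : R := Num.sqrt (n.+1%:R / 2).
  have r2 : r ^+ 2 = n.+1%:R / 2 by rewrite sqr_sqrtr// divr_ge0.
  have r0 : 0 < r by rewrite sqrtr_gt0 divr_gt0.
  have mr : measurable [set w | r < `|X w|].
    rewrite -[X in measurable X]setTI.
    rewrite (_ : [set w | r < `|X w|] = (fun w => `|X w|) @^-1` `]r, +oo[).
      by apply: measurableT_comp.
    by apply/seteqP; split => w; rewrite /= in_itv /= andbT.
  apply: (@le_trans _ _ (P [set w | r < `|X w|])).
    apply: le_measure; rewrite ?inE// => w; rewrite /A /= => nX.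
    rewrite -(@ltr_pXn2r _ 2)// ?nnegrE ?(ltW r0)// r2 real_normK ?num_real//.
    apply: lt_le_trans nX; rewrite ltr_pdivrMr// ltr_pMr// ?ltr0n//.
    by rewrite ltr1n.
  apply: (le_trans (tailX _ r0)); rewrite lee_fin r2 ler_pM// ?expR_ge0 ?(ltW K0)//.
    by rewrite lerDl.
  by rewrite ler_expR /s; lra.
pose F n w : \bar R := (expR (s * n.+1%:R) * \1_(A n) w)%:E.
have mF n : measurable_fun [set: T] (F n).
  apply/measurable_EFinP; apply: measurable_funM => //; exact: measurable_indic.
have F0 n w : (0 <= F n w)%E by rewrite lee_fin mulr_ge0 ?expR_ge0.
apply: (@le_trans _ _ (\int[P]_w (\sum_(n <oo) F n w))%E).
  apply: ge0_le_integral => //.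
  - apply/measurable_EFinP; apply: measurableT_comp => //.
    exact: measurable_funM.
  - by apply: ge0_emeasurable_sum.
  - move=> w _; pose n := Num.truncn (X w ^+ 2).
    have /andP[nX Xn] := truncn_itv (sqr_ge0 (X w)).
    apply: (@le_trans _ _ (\sum_(0 <= i < n.+1) F i w)%E); last exact: nneseries_lim_ge.
    rewrite big_nat_recr//=; apply: (@le_trans _ _ (F n w)).
      rewrite /F indicE mem_set// mulr1 lee_fin ler_expR ler_pM2l//.
      exact: ltW.
    by rewrite leeDr// sume_ge0.
rewrite integral_nneseries//.
pose a := (K + 1) * expR s; pose z := expR (- s).
have z1 : `|z| < 1 by rewrite ger0_norm ?expR_ge0// expR_lt1 oppr_lt0.
apply: (@le_trans _ _ (\sum_(n <oo) (geometric a z n)%:E)%E).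
  apply: lee_nneseries => [n _ _|n _].
    by apply: integral_ge0 => w _; exact: F0.
  rewrite /F; under eq_integral do rewrite EFinM.
  rewrite ge0_integralZl_EFin ?expR_ge0//; last first.
    by apply/measurable_EFinP; exact: measurable_indic.
  rewrite integral_indic// setIT.
  apply: (@le_trans _ _ ((expR (s * n.+1%:R))%:E * ((K + 1) * expR (- (2 * s * n%:R)))%:E)%E).
    by apply: lee_wpmul2l (PA n); rewrite lee_fin expR_ge0.
  rewrite -EFinM lee_fin /geometric /a /z /= -expRM_natr.
  rewrite mulrCA -expRD -[leRHS]mulrA -expRD -natr1.
  by rewrite (_ : s * (n%:R + 1) - 2 * s * n%:R = s + - s * n%:R) //; ring.
rewrite le_eqVlt; apply/orP; left; apply/eqP/cvg_lim => //.
under eq_fun do rewrite sumEFin.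
apply: cvg_EFin; first exact: nearW.
exact: cvg_geometric_series.
Qed.

(** Convexity of exp between 0 and u, obtained by averaging the tangent
inequalities at theta u. *)
Lemma expR_mul_le_convex (R : realType) (theta u : R) : 0 <= theta <= 1 ->
  expR (theta * u) <= 1 - theta + theta * expR u.
Proof.
move=> /andP[t0 t1]; have e0 := expR_gt0 (theta * u).
have h1 : expR (theta * u) * (1 + (1 - theta) * u) <= expR u.
  rewrite [leRHS](_ : _ = expR (theta * u) * expR ((1 - theta) * u)).
    by rewrite ler_pM2l// expR_ge1Dx.
  by rewrite -expRD; congr expR; ring.
have h2 : expR (theta * u) * (1 - theta * u) <= 1.
  rewrite [leRHS](_ : _ = expR (theta * u) * expR (- (theta * u))).
    by rewrite ler_pM2l// expR_ge1Dx.
  by rewrite -expRD subrr expR0.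
have h3 := ler_wpM2l t0 h1; have t1' : 0 <= 1 - theta by lra.
have h4 := ler_wpM2l t1' h2; lra.
Qed.

(** Integrability of [X] comes from |X| <= s X^2 + 1 / (4 s). *)
Lemma integrable_of_expR_sqr d (T : measurableType d) (R : realType)
    (P : probability T R) (X : {RV P >-> R}) (s M : R) : 0 < s ->
  (\int[P]_w (expR (s * X w ^+ 2))%:E <= M%:E)%E ->
  P.-integrable [set: T] (EFin \o (fun w => expR (s * X w ^+ 2))) /\
  P.-integrable [set: T] (EFin \o X).
Proof.
move=> s0 EM; pose G w := expR (s * X w ^+ 2).
have mX : measurable_fun [set: T] X by [].
have mG : measurable_fun [set: T] G.
  by apply: measurableT_comp => //; apply: measurable_funM => //; exact: measurable_funX.
have GI : P.-integrable [set: T] (EFin \o G).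
  apply/integrableP; split; first exact/measurable_EFinP.
  rewrite (eq_integral (EFin \o G)); first by rewrite (le_lt_trans EM)// ltry.
  by move=> w _; rewrite /= ger0_norm// expR_ge0.
split=> //.
  have cI : P.-integrable [set: T] (EFin \o (fun w => G w + (4 * s)^-1)).
    have c1 : P.-integrable [set: T] (EFin \o cst (4 * s)^-1).
      exact: finite_measure_integrable_cst.
    by have := integrableD measurableT GI c1.
  apply: le_integrable cI => //; first exact/measurable_EFinP.
  move=> w _ /=; rewrite lee_fin [leRHS]ger0_norm; last first.
    by rewrite addr_ge0 ?expR_ge0// invr_ge0 mulr_ge0// ltW.
  have h := expR_ge1Dx (s * X w ^+ 2).
  have h1 : 0 <= s * (`|X w| - (2 * s)^-1) ^+ 2 by rewrite mulr_ge0 ?sqr_ge0// ltW.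
  have h2 : s * (`|X w| - (2 * s)^-1) ^+ 2 = s * X w ^+ 2 - `|X w| + (4 * s)^-1.
    rewrite sqrrB real_normK ?num_real//; field; exact: lt0r_neq0.
  rewrite /G; lra.
Qed.

(** Write theta = 2 t^2 / s. For small t, theta <= 1 and
exp(t X) <= t X + exp(theta s X^2), whose expectation is at most
1 + theta (M - 1) by convexity. For large t,
t X <= t^2 / (4 s) + s X^2 gives the factor M <= exp(theta M). The exponent in
the statement is the sum of those of the two regimes. *)
Lemma mgf_le_of_expR_sqr d (T : measurableType d) (R : realType)
    (P : probability T R) (X : {RV P >-> R}) (s M : R) : 0 < s ->
  ('E_P[X] = 0)%E ->
  (\int[P]_w (expR (s * X w ^+ 2))%:E <= M%:E)%E ->
  forall t, (\int[P]_w (expR (t * X w))%:E <=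
    (expR ((2 * M + 4^-1) / s * t ^+ 2))%:E)%E.
Proof.
move=> s0 EX EM t; pose G w := expR (s * X w ^+ 2).
have mX : measurable_fun [set: T] X by [].
have mG : measurable_fun [set: T] G.
  by apply: measurableT_comp => //; apply: measurable_funM => //; exact: measurable_funX.
have G0 w : 0 <= G w by exact: expR_ge0.
have metX : measurable_fun [set: T] (fun w => expR (t * X w)).
  by apply: measurableT_comp => //; exact: measurable_funM.
have M0 : 0 <= M.
  by rewrite -lee_fin (le_trans _ EM)//; apply: integral_ge0 => w _; rewrite lee_fin.
have [GI XI] := integrable_of_expR_sqr s0 EM.
pose th := 2 * t ^+ 2 / s.
have th0 : 0 <= th by rewrite divr_ge0 ?(ltW s0)// mulr_ge0 ?sqr_ge0.
have -> : (2 * M + 4^-1) / s * t ^+ 2 = th * M + t ^+ 2 / (4 * s).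
  by rewrite /th; field; exact: lt0r_neq0.
have t40 : 0 <= t ^+ 2 / (4 * s) by rewrite divr_ge0 ?sqr_ge0// mulr_ge0 ?(ltW s0).
have [th1|th1] := leP th 1.
  pose H : T -> R := (t \o* X \+ (th \o* G \+ cst (1 - th))).
  have XL : (X : T -> R) \in Lfun P 1 by exact/Lfun1_integrable.
  have GL : G \in Lfun P 1 by exact/Lfun1_integrable.
  have EG : ('E_P[G] <= M%:E)%E by rewrite unlock.
  have HE : ('E_P[H] <= (th * M + (1 - th))%:E)%E.
    rewrite expectationD ?rpredD ?Lfun_scale ?Lfun_cst//.
    rewrite expectationD ?Lfun_scale ?Lfun_cst//.
    rewrite !expectationZl// EX mule0 add0e expectation_cst.
    rewrite [leRHS]EFinD; apply: leeD => //.
    by rewrite EFinM; apply: lee_wpmul2l EG; rewrite lee_fin.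
  have eH w : expR (t * X w) <= H w.
    apply: (le_trans (expR_le_addr_expR_sqr _)).
    rewrite /H /= mulrC lerD2l [G w * th]mulrC addrC.
    rewrite (_ : 2 * _ = th * (s * X w ^+ 2)); last by rewrite /th; field; exact: lt0r_neq0.
    by apply: expR_mul_le_convex; rewrite th0.
  apply: (@le_trans _ _ 'E_P[H])%E.
    rewrite unlock; apply: ge0_le_integral => //.
    - by apply/measurable_EFinP.
    - apply/measurable_EFinP; apply: measurable_funD; last apply: measurable_funD => //.
      + by apply: measurable_funM.
      + by apply: measurable_funM.
    - by move=> w _; rewrite lee_fin.
  apply: (le_trans HE); rewrite lee_fin.
  have := expR_ge1Dx (th * M + t ^+ 2 / (4 * s)).
  by move: t40; lra.
apply: (@le_trans _ _ (\int[P]_w ((expR (t ^+ 2 / (4 * s)))%:E * (G w)%:E))%E).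
  apply: ge0_le_integral => //.
  - by apply/measurable_EFinP.
  - by apply: measurable_funeM; apply/measurable_EFinP.
  - move=> w _; rewrite -EFinM lee_fin -expRD ler_expR.
    have h1 : 0 <= s * (X w - t / (2 * s)) ^+ 2 by rewrite mulr_ge0 ?sqr_ge0// ltW.
    have h2 : s * (X w - t / (2 * s)) ^+ 2 = s * X w ^+ 2 - t * X w + t ^+ 2 / (4 * s).
      by field; exact: lt0r_neq0.
    by rewrite h2 in h1; lra.
rewrite ge0_integralZl_EFin ?expR_ge0//; last 2 first.
- by move=> w _; rewrite lee_fin.
- exact/measurable_EFinP.
apply: (@le_trans _ _ ((expR (t ^+ 2 / (4 * s)))%:E * M%:E)%E).
  by apply: lee_wpmul2l EM; rewrite lee_fin expR_ge0.
rewrite -EFinM lee_fin addrC expRD ler_pM2l ?expR_gt0//.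
apply: (@le_trans _ _ (expR M)); first by have := expR_ge1Dx M; lra.
by rewrite ler_expR ler_peMl// ltW.
Qed.

(** The constant depends on the tail only, so it serves all indices at once. *)
Lemma sub_gaussian_mgf d (T : measurableType d) (R : realType)
    (P : probability T R) (X : nat -> {RV P >-> R}) :
  (forall i, 'E_P[X i] = 0)%E -> sub_gaussian X ->
  exists c : R, [/\ 0 < c, forall i, (X i : T -> R) \in Lfun P 1 & forall i t,
    (\int[P]_w (expR (t * X i w))%:E <= (expR (c * t ^+ 2))%:E)%E].
Proof.
move=> EX [C [K [C0 K0 tailX]]]; have s0 : 0 < C / 4 by rewrite divr_gt0.
pose M := (K + 1) * expR (C / 4) / (1 - expR (- (C / 4))).
have M0 : 0 < M.
  apply: divr_gt0; first by rewrite mulr_gt0 ?expR_gt0 ?addr_gt0.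
  by rewrite subr_gt0 expR_lt1 oppr_lt0.
have EM i := expR_sqr_moment_le C0 K0 (tailX i).
exists ((2 * M + 4^-1) / (C / 4)); split.
- by apply: divr_gt0 => //; lra.
- by move=> i; apply/Lfun1_integrable; have [] := integrable_of_expR_sqr s0 (EM i).
- by move=> i t; exact: mgf_le_of_expR_sqr.
Qed.

(** * Tails of weighted sums *)

Section weighted_sums.
Context d (T : measurableType d) (R : realType) (P : probability T R).
Variables (X : nat -> {RV P >-> R}) (c : R).
Hypothesis indep : mutually_independent X.
Hypothesis c0 : 0 < c.
Hypothesis mgfX : forall i t,
  (\int[P]_w (expR (t * X i w))%:E <= (expR (c * t ^+ 2))%:E)%E.

Lemma measurable_weighted_sum n (a : 'I_n -> R) :
  measurable_fun [set: T] (fun w => \sum_(i < n) a i * X i w).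
Proof. by apply: measurable_sum => i; exact: measurable_funM. Qed.

Lemma mgf_weighted_sum n (a : 'I_n -> R) t :
  (\int[P]_w (expR (t * \sum_(i < n) a i * X i w))%:E <=
   (expR (c * t ^+ 2 * \sum_(i < n) a i ^+ 2))%:E)%E.
Proof.
(* the weights are extended by 0, as the product lemma is indexed by nat *)
pose b i := if insub i is Some j then a j else 0.
have bE (i : 'I_n) : b i = a i by rewrite /b valK.
pose f i y := expR (t * b i * y).
have mf i : measurable_fun [set: R] (f i).
  by apply: measurableT_comp => //; exact: measurable_funM.
have f0 i y : 0 <= f i y by exact: expR_ge0.
have Ef i : (\int[P]_w (f i (X i w))%:E <= (expR (c * (t * b i) ^+ 2))%:E)%E.
  exact: mgfX.
rewrite (eq_integral (fun w => (\prod_(i < n) f i (X i w))%:E)); last first.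
  move=> w _; congr EFin; rewrite mulr_sumr expR_sum; apply: eq_bigr => i _.
  by rewrite /f bE mulrA.
rewrite ge0_integral_prod_indep//; last first.
  move=> i; rewrite ge0_fin_numE ?(le_lt_trans (Ef i)) ?ltry//.
  by apply: integral_ge0 => w _; rewrite lee_fin.
apply: (@le_trans _ _ (\prod_(i < n) (expR (c * (t * b i) ^+ 2))%:E)%E).
  suff [] : (0 <= \prod_(i < n) \int[P]_w (f i (X i w))%:E)%E /\
    (\prod_(i < n) \int[P]_w (f i (X i w))%:E <=
     \prod_(i < n) (expR (c * (t * b i) ^+ 2))%:E)%E by [].
  apply: (big_ind2 (fun x y : \bar R => (0 <= x)%E /\ (x <= y)%E)) => //.
  - move=> x1 x2 y1 y2 [x10 x12] [y10 y12]; split; first exact: mule_ge0.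
    exact: lee_pmul.
  - by move=> i _; split=> //; apply: integral_ge0 => w _; rewrite lee_fin.
rewrite prodEFin lee_fin -expR_sum mulr_sumr le_eqVlt; apply/orP; left.
by apply/eqP; congr expR; apply: eq_bigr => i _; rewrite bE exprMn mulrA.
Qed.

Lemma weighted_sum_tail n (a : 'I_n -> R) (A u : R) :
  0 < A -> \sum_(i < n) a i ^+ 2 <= A -> 0 < u ->
  (P [set w | (u <= `|\sum_(i < n) a i * X i w|)%R] <=
   (2 * expR (- (u ^+ 2 / (4 * c * A))))%:E)%E.
Proof.
move=> A0 aA u0.
have mge (g : T -> R) : measurable_fun [set: T] g -> measurable [set w | u <= g w].
  move=> mg; rewrite -[X in measurable X]setTI.
  rewrite (_ : [set w | u <= g w] = g @^-1` `[u, +oo[); first exact: mg.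
  by apply/seteqP; split => w; rewrite /= in_itv /= andbT.
have one (b : 'I_n -> R) : \sum_(i < n) b i ^+ 2 <= A ->
    (P [set w | (u <= \sum_(i < n) b i * X i w)%R] <=
     (expR (- (u ^+ 2 / (4 * c * A))))%:E)%E.
  (* this t minimizes the Chernoff exponent c t^2 A - t u *)
  move=> bA; pose t := u / (2 * c * A).
  have t0 : 0 < t by rewrite divr_gt0// !mulr_gt0.
  have mS := measurable_weighted_sum b.
  pose S : {RV P >-> R} := mfun_Sub (mem_set mS).
  apply: (le_trans (chernoff S u t0)).
  have -> : 'M_P S t = (\int[P]_w (expR (t * \sum_(i < n) b i * X i w))%:E)%E.
    by rewrite /mmt_gen_fun unlock; apply: eq_integral => w _; rewrite /= mulrC.
  apply: (@le_trans _ _ ((expR (c * t ^+ 2 * A))%:E * (expR (- (t * u)))%:E)%E).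
    apply: lee_wpmul2r; first by rewrite lee_fin expR_ge0.
    apply: (le_trans (mgf_weighted_sum b t)); rewrite lee_fin ler_expR.
    by rewrite ler_wpM2l// mulr_ge0 ?sqr_ge0// ltW.
  rewrite -EFinM lee_fin -expRD ler_expR le_eqVlt; apply/orP; left; apply/eqP.
  by rewrite /t; field; rewrite !lt0r_neq0.
have mS b := @measurable_weighted_sum n b.
apply: (@le_trans _ _ (P ([set w | (u <= \sum_(i < n) a i * X i w)%R] `|`
    [set w | (u <= \sum_(i < n) - a i * X i w)%R]))).
  apply: le_measure; rewrite ?inE.
  - by apply: mge; apply: measurableT_comp.
  - by apply: measurableU; apply: mge.
  - move=> w /=; under [X in _ \/ _ <= X]eq_bigr do rewrite mulNr.
    by rewrite sumrN ler_normr => /orP[]; [left|right].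
apply: (le_trans (measureU2 _ _ _)); try exact: mge.
rewrite mulr_natl mulr2n EFinD; apply: leeD; apply: one => //.
by under eq_bigr do rewrite sqrrN.
Qed.

End weighted_sums.

(** * The scalar bridge problem *)

Section bridge_coordinate.
Context (R : realType) (gamma N S lambda : R).
Hypothesis hgamma : 0 < gamma < 1.
Hypothesis N0 : 0 < N.
Let q b := N * b ^+ 2 - 2 * S * b + lambda * `|b| `^ gamma.

(** For b nonzero and r = |b|, q b >= r (N r + lambda r^(gamma - 1) - 2 |S|).
The first summand is at least N t when r >= t, the second when r <= t, because
lambda = N t^(2 - gamma); as the other one is positive, q b > 0 = q 0. *)
Lemma bridge_coordinate_eq0 (t b : R) : 0 < t -> lambda = N * t `^ (2 - gamma) ->
  2 * `|S| <= N * t -> q b <= q 0 -> b = 0.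
Proof.
move=> t0 lamE St; rewrite /q normr0 powR0 ?lt0r_neq0//; last by case/andP: hgamma.
rewrite expr0n /= !mulr0 subrr addr0 => qb; apply/eqP; apply: contraT => b0.
have {b0}r0 : 0 < `|b| by rewrite normr_gt0.
set r := `|b| in qb r0.
have lam0 : 0 < lambda by rewrite lamE mulr_gt0// powR_gt0.
have rg0 : 0 < lambda * r `^ gamma by rewrite mulr_gt0// powR_gt0.
have Sb : 2 * S * b <= N * t * r.
  apply: le_trans (_ : 2 * `|S| * r <= _); last by rewrite ler_pM2r.
  by rewrite -!mulrA ler_pM2l// -normrM ler_norm.
have br : b ^+ 2 = r ^+ 2 by rewrite real_normK ?num_real.
rewrite br in qb.
have [tr|rt] := leP t r.
  have : N * t * r <= N * r ^+ 2 by rewrite -mulrA expr2 ler_pM2l// ler_pM2r.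
  by lra.
have pg : 0 <= 1 - gamma by case/andP: hgamma => _ /ltW; rewrite subr_ge0.
have : N * t * r <= lambda * r `^ gamma.
  rewrite lamE (_ : 2 - gamma = 1 + (1 - gamma)); last by ring.
  have rE : r = r `^ gamma * r `^ (1 - gamma).
    by rewrite -powRD ?(gt_eqF r0) ?implybT// addrC subrK powRr1// ltW.
  have tE : t `^ (1 + (1 - gamma)) = t * t `^ (1 - gamma).
    by rewrite powRD ?(gt_eqF t0) ?implybT// powRr1// ltW.
  rewrite tE [in leLHS]rE -!mulrA ler_pM2l// ler_pM2l// mulrC ler_pM2r ?powR_gt0//.
  by apply: ge0_ler_powR; rewrite ?nnegrE// ltW.
have : 0 < N * r ^+ 2 by rewrite mulr_gt0// exprn_gt0.
by lra.
Qed.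

(** The least-squares value S / N already beats 0: there q equals
- S^2 / N + lambda |S / N|^gamma, which is negative. *)
Lemma bridge_coordinate_neq0 (r b : R) : 0 < r -> r <= `|S / N| ->
  lambda / N < r `^ (2 - gamma) -> (forall b', q b <= q b') -> b != 0.
Proof.
move=> r0 rS lr qmin; apply/eqP => b0; have := qmin (S / N).
rewrite b0 /q normr0 powR0 ?lt0r_neq0//; last by case/andP: hgamma.
rewrite expr0n /= !mulr0 subrr addr0.
set s := S / N in rS *; have SE : S = N * s by rewrite /s mulrC divfK// lt0r_neq0.
have s0 : 0 < `|s| by exact: lt_le_trans rS.
apply/negP; rewrite -ltNge {1}SE.
have lrs : lambda < N * `|s| `^ (2 - gamma).
  rewrite -ltr_pdivrMl// mulrC; apply: (lt_le_trans lr).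
  apply: ge0_ler_powR; rewrite ?nnegrE//; last exact: ltW.
  by case/andP: hgamma => _; lra.
have : lambda * `|s| `^ gamma < N * `|s| ^+ 2.
  rewrite -powR_mulrn// (_ : 2%:R = (2 - gamma) + gamma); last by ring.
  by rewrite powRD ?(gt_eqF s0) ?implybT// mulrA ltr_pM2r ?powR_gt0.
by rewrite real_normK ?num_real//; lra.
Qed.

End bridge_coordinate.

(** Changing one coordinate of a minimizer leaves the other terms of the
separable objective fixed. *)
Lemma bridge_objective_coordinate (R : realType) (n k m : nat)
    (x : 'M[R]_(n, k + m)) (y : 'I_n -> R) (lambda gamma : R)
    (beta : 'cV[R]_(k + m)) (j : 'I_(k + m)) (b : R) :
  (0 < n)%N -> standardized x ->
  (forall beta', bridge_objective x y lambda gamma beta <=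
                 bridge_objective x y lambda gamma beta') ->
  let q b := n%:R * b ^+ 2 - 2 * (\sum_i y i * x i j) * b + lambda * `|b| `^ gamma in
  q (beta j 0) <= q b.
Proof.
move=> n0 std bmin /=.
pose beta' : 'cV[R]_(k + m) := \col_l (if l == j then b else beta l 0).
have := bmin beta'; rewrite /bridge_objective !mulr_sumr -!big_split /=.
rewrite (bigD1 j)//= [leRHS](bigD1 j)//=.
rewrite [X in _ <= _ + X](eq_bigr (fun l => \sum_i (y i - x i l * beta l 0) ^+ 2 +
   lambda * `|beta l 0| `^ gamma)); last first.
  by move=> l lj; rewrite mxE (negbTE lj).
rewrite lerD2r mxE eqxx.
have expand c : \sum_i (y i - x i j * c) ^+ 2 =
    \sum_i y i ^+ 2 + (n%:R * c ^+ 2 - 2 * (\sum_i y i * x i j) * c).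
  have nE : n%:R = \sum_i x i j ^+ 2.
    have nn0 : n%:R != 0 :> R by rewrite pnatr_eq0 -lt0n.
    have [_ h] := std j; apply: (@mulfI _ n%:R^-1); first by rewrite invr_eq0.
    by rewrite h mulVf.
  rewrite nE mulr_suml mulr_sumr mulr_suml -sumrB -big_split /=.
  by apply: eq_bigr => i _; ring.
by rewrite !expand mulr_sumr; lra.
Qed.

(** * Probabilities of finite intersections *)

Lemma measure_exists_fin_le d (T : measurableType d) (R : realType)
    (P : {measure set T -> \bar R}) (I : finType) (B : I -> set T) (delta : R) :
  (forall i, measurable (B i)) -> (forall i, P (B i) <= delta%:E)%E ->
  (P [set w | exists i, B i w] <= (#|I|%:R * delta)%:E)%E.
Proof.
move=> mB PB.
have -> : [set w | exists i, B i w] = \big[setU/set0]_(i : I) B i.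
  apply/seteqP; split=> w /=.
    by case=> i Bi; rewrite (bigD1 i)//=; left.
  elim/big_ind : _ => //= [A A' IA IA' []|i _ Bi]; [exact: IA|exact: IA'|by exists i].
have mS (s : seq I) : measurable (\big[setU/set0]_(i <- s) B i) by exact: bigsetU_measurable.
have : (P (\big[setU/set0]_(i <- index_enum I) B i) <= \sum_(i <- index_enum I) P (B i))%E.
  elim: (index_enum I) => [|i s IH]; first by rewrite !big_nil measure0.
  rewrite !big_cons; apply: (le_trans (measureU2 _ _ _)) => //.
  exact: leeD.
move/le_trans; apply; apply: (@le_trans _ _ (\sum_(i : I) delta%:E)%E).
  exact: lee_sum.
by rewrite sumEFin lee_fin sumr_const mulr_natl.
Qed.

Lemma measurable_forall_fin d (T : measurableType d) (I : finType) (A : I -> set T) :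
  (forall i, measurable (A i)) -> measurable [set w | forall i, A i w].
Proof.
move=> mA; rewrite (_ : [set w | _] = \bigcap_(i in [set: I]) A i).
  by apply: fin_bigcap_measurable => //; exact: finite_finset.
by apply/seteqP; split => w /= Aw i; [move=> _|]; exact: Aw.
Qed.

(** Union bound for the complements; the larger events [B i] are those whose
probability is estimated. *)
Lemma probability_forall_ge d (T : measurableType d) (R : realType)
    (P : probability T R) (I : finType) (A B : I -> set T) (delta : R) :
  (forall i, measurable (A i)) -> (forall i, measurable (B i)) ->
  (forall i, ~` A i `<=` B i) -> (forall i, P (B i) <= delta%:E)%E ->
  ((1 - #|I|%:R * delta)%:E <= P [set w | forall i, A i w])%E.
Proof.
move=> mA mB AB PB.
have mAc i : measurable (~` A i) by exact: measurableC.
have PA i : (P (~` A i) <= delta%:E)%E.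
  by apply: le_trans (PB i); apply: le_measure; rewrite ?inE.
have -> : [set w | forall i, A i w] = ~` [set w | exists i, (~` A i) w].
  apply/seteqP; split => w /=; first by move=> Aw [i]; apply.
  by move=> nA i; apply: contrapT => nAi; apply: nA; exists i.
have mE : measurable [set w | exists i, (~` A i) w].
  rewrite (_ : [set w | _] = ~` [set w | forall i, A i w]).
    by apply: measurableC; exact: measurable_forall_fin.
  apply/seteqP; split => w /=; first by move=> [i nAi] /(_ i).
  move=> nA; apply: contrapT => nE; apply: nA => i.
  by apply: contrapT => nAi; apply: nE; exists i.
rewrite probability_setC// EFinB; apply: leeB => //.
exact: measure_exists_fin_le.
Qed.

Lemma cvg_probability1 (R : realType) (u : nat -> \bar R) :
  (\forall n \near \oo, u n <= 1)%E ->
  (forall e : R, 0 < e -> \forall n \near \oo, ((1 - e)%:E <= u n)%E) ->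
  u @ \oo --> 1%E.
Proof.
move=> u1 ue; apply/fine_cvgP; split.
  near=> n; rewrite fin_numElt; apply/andP; split.
    apply: (@lt_le_trans _ _ (1 - 1)%:E); first exact: ltNyr.
    by near: n; exact: ue.
  by apply: (@le_lt_trans _ _ 1%E); [near: n|exact: ltry].
apply/cvgrPdist_le => e e0; near=> n => /=.
have un1 : (u n <= 1)%E by near: n.
have une : ((1 - e)%:E <= u n)%E by near: n; exact: ue.
have ufin : u n \is a fin_num.
  by rewrite fin_numElt (lt_le_trans _ une) ?ltNyr// (le_lt_trans un1) ?ltry.
move: un1 une; rewrite -(fineK ufin) !lee_fin /= => un1 une.
by rewrite ler_norml; apply/andP; split; lra.
Unshelve. all: by end_near. Qed.

(** * Signal and noise in the marginal correlations *)

Section response_moments.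
Context d (T : measurableType d) (R : realType) (P : probability T R).
Context (n k m : nat) (x : 'M[R]_(n, k + m)) (b : 'cV[R]_k) (eps : nat -> {RV P >-> R}).
Hypothesis eps_mean : forall i, ('E_P[eps i] = 0)%E.
Hypothesis eps_int : forall i, (eps i : T -> R) \in Lfun P 1.

Lemma xiE j : xi x b eps j = n%:R^-1 * \sum_i (x *m true_parameter m b) i 0 * x i j.
Proof.
rewrite /xi; congr (_ * _).
pose N w := \sum_(i <- index_enum 'I_n) x i j * eps i w.
have [NL EN] : N \in Lfun P 1 /\ ('E_P[N] = 0)%E.
  rewrite /N; elim: (index_enum 'I_n) => [|i s [IHL IHE]].
    rewrite (_ : (fun _ => _) = cst 0); last by apply/funext => w; rewrite big_nil.
    by rewrite expectation_cst Lfun_cst.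
  rewrite (_ : (fun _ => _) = (x i j \o* eps i) \+
    (fun w => \sum_(i <- s) x i j * eps i w)); last first.
    by apply/funext => w; rewrite big_cons /= mulrC.
  rewrite expectationD ?Lfun_scale// expectationZl// eps_mean mule0 add0e.
  by split=> //; rewrite rpredD// Lfun_scale.
rewrite (_ : (fun w => _) = cst (\sum_i (x *m true_parameter m b) i 0 * x i j) \+ N).
  by rewrite expectationD ?Lfun_cst// EN adde0 expectation_cst.
apply/funext => w; rewrite /N /= -big_split; apply: eq_bigr => i _.
by rewrite /response /=; ring.
Qed.

Lemma sum_responseE j w : (0 < n)%N ->
  \sum_i response x b eps i w * x i j =
  n%:R * xi x b eps j + \sum_i x i j * eps i w.
Proof.
move=> n0; rewrite xiE mulrA mulfV ?mul1r ?pnatr_eq0 -?lt0n//.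
by rewrite -big_split; apply: eq_bigr => i _; rewrite /response /=; ring.
Qed.

End response_moments.

(** * Selection probabilities at a fixed sample size *)

Section marginal_bridge.
Context d (T : measurableType d) (R : realType) (P : probability T R).
Context (eps : nat -> {RV P >-> R}) (c gamma : R).
Context (n k m : nat) (x : 'M[R]_(n, k + m)) (b : 'cV[R]_k) (lambda : R).
Context (betat : T -> 'cV[R]_(k + m)).
Hypothesis eps_indep : mutually_independent eps.
Hypothesis eps_mean : forall i, ('E_P[eps i] = 0)%E.
Hypothesis eps_int : forall i, (eps i : T -> R) \in Lfun P 1.
Hypothesis c0 : 0 < c.
Hypothesis eps_mgf : forall i t,
  (\int[P]_w (expR (t * eps i w))%:E <= (expR (c * t ^+ 2))%:E)%E.
Hypothesis hgamma : 0 < gamma < 1.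
Hypothesis n0 : (0 < n)%N.
Hypothesis std : standardized x.
Hypothesis betat_meas : forall j, measurable_fun [set: T] (fun w => betat w j 0).
Hypothesis betat_min : forall w beta,
  bridge_objective x (fun i => response x b eps i w) lambda gamma (betat w) <=
  bridge_objective x (fun i => response x b eps i w) lambda gamma beta.

Let nn0 : 0 < n%:R :> R. Proof. by rewrite ltr0n. Qed.

Let noise j w := \sum_i x i j * eps i w.

Lemma noise_tail j u : 0 < u ->
  (P [set w | (u <= `|noise j w|)%R] <= (2 * expR (- (u ^+ 2 / (4 * c * n%:R))))%:E)%E.
Proof.
move=> u0; apply: weighted_sum_tail => //.
have [_ h] := std j.
by rewrite -(ler_pM2l (x := n%:R^-1)) ?invr_gt0// h mulVf// lt0r_neq0.
Qed.

Lemma measurable_noise_ge j u : measurable [set w | u <= `|noise j w|].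
Proof.
have mN : measurable_fun [set: T] (fun w => `|noise j w|).
  by apply: measurableT_comp => //; exact: measurable_weighted_sum.
rewrite -[X in measurable X]setTI.
rewrite (_ : [set w | _] = (fun w => `|noise j w|) @^-1` `[u, +oo[); first exact: mN.
by apply/seteqP; split => w; rewrite /= in_itv /= andbT.
Qed.

Lemma measurable_betat_eq0 j : measurable [set w | betat w j 0 = 0].
Proof.
rewrite -[X in measurable X]setTI.
rewrite (_ : [set w | _] = (fun w => betat w j 0) @^-1` [set 0]) //.
exact: betat_meas.
Qed.

Lemma dsubmx_eq0E : [set w | dsubmx (betat w) = 0] =
  [set w | forall j : 'I_m, betat w (rshift k j) 0 = 0].
Proof.
apply/seteqP; split => w /=.
  by move=> /colP bw j; have := bw j; rewrite !mxE.
by move=> bw; apply/colP => j; rewrite !mxE.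
Qed.

Lemma measurable_dsubmx_eq0 : measurable [set w | dsubmx (betat w) = 0].
Proof.
rewrite dsubmx_eq0E; apply: measurable_forall_fin => j.
exact: measurable_betat_eq0.
Qed.

Lemma measurable_usubmx_neq0 l : measurable [set w | usubmx (betat w) l 0 != 0].
Proof.
rewrite (_ : [set w | _] = ~` [set w | betat w (lshift m l) 0 = 0]).
  by apply: measurableC; exact: measurable_betat_eq0.
by apply/seteqP; split => w /=; rewrite mxE => /eqP.
Qed.

(** A nonzero estimate of a zero coefficient needs 2 |S_j| > sqrt n h. The
signal accounts for at most a quarter of sqrt n h in |S_j|, so the noise must
exceed another quarter. *)
Lemma probability_zero_part_ge (h b1 c1 : R) : 0 < h ->
  lambda = n%:R * (h / Num.sqrt n%:R) `^ (2 - gamma) ->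
  (forall (j : 'I_m) (l : 'I_k), `| (Num.sqrt n%:R)^-1 *
          \sum_i x i (rshift k j) * x i (lshift m l) | <= c1) ->
  (forall l, `|b l 0| <= b1) ->
  b1 * c1 * k%:R <= h / 4 ->
  ((1 - m%:R * (2 * expR (- (h ^+ 2 / (64 * c)))))%:E <=
    P [set w | dsubmx (betat w) = 0%R])%E.
Proof.
move=> h0 lamE orth bb1 kh; set rn : R := Num.sqrt n%:R in lamE orth.
have rn0 : 0 < rn by rewrite sqrtr_gt0.
have rn2 : rn ^+ 2 = n%:R by rewrite sqr_sqrtr// ltW.
rewrite -[m in m%:R]card_ord.
rewrite dsubmx_eq0E.
apply: (probability_forall_ge (A := fun j => [set w | betat w (rshift k j) 0 = 0])
  (B := fun j => [set w | rn * h / 4 <= `|noise (rshift k j) w|])).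
- by move=> j; exact: measurable_betat_eq0.
- by move=> j; exact: measurable_noise_ge.
- move=> j w /=; apply: contra_notP => /negP; rewrite -ltNge => Nsmall.
  pose S := \sum_i response x b eps i w * x i (rshift k j).
  apply: (@bridge_coordinate_eq0 _ gamma n%:R S lambda hgamma nn0 (h / rn)) => //.
  + by rewrite divr_gt0.
  + have -> : n%:R * (h / rn) = rn * h by rewrite -rn2; field; exact: lt0r_neq0.
    rewrite /S sum_responseE//.
    have xib : `|n%:R * xi x b eps (rshift k j)| <= rn * (h / 4).
      rewrite xiE// mulVKf ?lt0r_neq0//.
      have -> : \sum_i (x *m true_parameter m b) i 0 * x i (rshift k j) =
          rn * \sum_l b l 0 * (rn^-1 * \sum_i x i (rshift k j) * x i (lshift m l)).
        rewrite mulr_sumr; under eq_bigr do rewrite mxE mulr_suml.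
        rewrite exchange_big /= big_split_ord /= [X in _ + X]big1 ?addr0.
          apply: eq_bigr => l _; rewrite mulrCA mulVKf ?lt0r_neq0//.
          rewrite mulr_sumr; apply: eq_bigr => i _.
          by rewrite /true_parameter col_mxEu; ring.
        move=> l _; apply: big1 => i _.
        by rewrite /true_parameter col_mxEd mxE mulr0 mul0r.
      rewrite normrM (gtr0_norm rn0) ler_pM2l//; apply: le_trans kh.
      apply: (le_trans (ler_norm_sum _ _ _)).
      rewrite mulr_natr -[X in _ *+ X]card_ord -sumr_const; apply: ler_sum => l _.
      by rewrite normrM ler_pM.
    have := ler_normD (n%:R * xi x b eps (rshift k j)) (noise (rshift k j) w).
    rewrite /noise in Nsmall *; lra.
  + exact: bridge_objective_coordinate.
- move=> j; have h4 : 0 < rn * h / 4 by rewrite divr_gt0// mulr_gt0.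
  apply: (le_trans (noise_tail _ h4)); rewrite lee_fin.
  have -> // : (rn * h / 4) ^+ 2 / (4 * c * n%:R) = h ^+ 2 / (64 * c).
  by rewrite -rn2; field; rewrite !lt0r_neq0.
Qed.

(** A zero estimate of a nonzero coefficient needs |S_l| / n < xi0 / 2, whereas
the signal alone exceeds xi0; so the noise is at least n xi0 / 2. *)
Lemma probability_nonzero_part_ge (xi0 : R) : 0 < xi0 ->
  (forall l : 'I_k, xi0 < `|xi x b eps (lshift m l)|) ->
  lambda / n%:R < (xi0 / 2) `^ (2 - gamma) ->
  ((1 - k%:R * (2 * expR (- (n%:R * (xi0 ^+ 2 / (16 * c))))))%:E <=
    P [set w | forall l, (usubmx (betat w) l 0 != 0)%R])%E.
Proof.
move=> xi00 xil lamn; rewrite -[k in k%:R]card_ord.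
apply: (probability_forall_ge (A := fun l => [set w | usubmx (betat w) l 0 != 0])
  (B := fun l => [set w | n%:R * (xi0 / 2) <= `|noise (lshift m l) w|])).
- by move=> l; exact: measurable_usubmx_neq0.
- by move=> l; exact: measurable_noise_ge.
- move=> l w /=; apply: contra_notP => /negP; rewrite -ltNge => Nsmall.
  rewrite mxE.
  pose S := \sum_i response x b eps i w * x i (lshift m l).
  apply: (@bridge_coordinate_neq0 _ gamma n%:R S lambda hgamma nn0 (xi0 / 2)) => //.
  + by rewrite divr_gt0.
  + rewrite /S sum_responseE// mulrDl mulrAC mulfV ?mul1r ?lt0r_neq0//.
    have : `|noise (lshift m l) w / n%:R| <= xi0 / 2.
      by rewrite normrM normfV (gtr0_norm nn0) ler_pdivrMr// mulrC ltW.
    have := xil l; rewrite /noise.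
    set A := xi _ _ _ _; set B := _ / _ => h1 h2.
    have := ler_normB (A + B) B; rewrite addrK; lra.
  + by move=> b'; exact: bridge_objective_coordinate.
- move=> l; have h4 : 0 < n%:R * (xi0 / 2) by rewrite mulr_gt0// divr_gt0.
  apply: (le_trans (noise_tail _ h4)); rewrite lee_fin.
  have -> // : (n%:R * (xi0 / 2)) ^+ 2 / (4 * c * n%:R) = n%:R * (xi0 ^+ 2 / (16 * c)).
  by field; rewrite !lt0r_neq0.
Qed.

End marginal_bridge.

(** * Rates *)

Section rates.
Context (R : realType).
Implicit Types (gamma lambda a h delta q e : R).

Lemma lambda_threshold gamma lambda (n : nat) : gamma < 1 -> (0 < n)%N -> 0 <= lambda ->
  lambda = n%:R * ((lambda * n%:R `^ (- gamma / 2)) `^ (2 - gamma)^-1 /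
                   Num.sqrt n%:R) `^ (2 - gamma).
Proof.
move=> g1 n0 l0; have nn0 : 0 < n%:R :> R by rewrite ltr0n.
have g2 : 2 - gamma != 0 by rewrite gt_eqF//; lra.
rewrite powRM ?powR_ge0 ?invr_ge0 ?sqrtr_ge0// -powRrM mulVf// powRr1; last first.
  by rewrite mulr_ge0// powR_ge0.
have -> : (Num.sqrt n%:R)^-1 = n%:R `^ (- 2^-1) :> R by rewrite powRN powR12_sqrt// ltW.
rewrite -powRrM -mulrA -powRD ?(gt_eqF nn0) ?implybT//.
rewrite (_ : - gamma / 2 + - 2^-1 * (2 - gamma) = -1); last by field.
by rewrite powR_inv1// mulrC divfK// lt0r_neq0.
Qed.

Lemma threshold_ge gamma a D (k : nat) : gamma < 1 -> 0 < D -> (0 < k)%N ->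
  D `^ (2 - gamma) <= a * k%:R `^ (gamma - 2) -> D * k%:R <= a `^ (2 - gamma)^-1.
Proof.
move=> g1 D0 k0 Da; have kk0 : 0 < k%:R :> R by rewrite ltr0n.
have g2 : 0 < 2 - gamma by lra.
have Dk : (D * k%:R) `^ (2 - gamma) <= a.
  rewrite powRM ?(ltW D0) ?(ltW kk0)// -ler_pdivlMr ?powR_gt0//.
  by rewrite (_ : (k%:R `^ (2 - gamma))^-1 = k%:R `^ (gamma - 2)) // -powRN opprB.
rewrite -[leLHS](powRr1 (a := D * k%:R)); last by rewrite mulr_ge0 ?(ltW D0) ?(ltW kk0).
rewrite -[X in _ `^ X <= _](mulfV (lt0r_neq0 g2)) powRrM.
apply: ge0_ler_powR => //; rewrite ?nnegrE ?powR_ge0 ?invr_ge0 ?ltW//.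
by apply: lt_le_trans Dk; rewrite powR_gt0// mulr_gt0.
Qed.

(** Half of the exponent absorbs [m]; the other half is estimated by
exp y >= y and h^2 >= h. *)
Lemma zero_union_bound_le delta h e (m : nat) : 0 < delta -> 0 < e -> 1 <= h ->
  2 / (e * delta) <= h -> ln m%:R <= delta * h ^+ 2 ->
  m%:R * (2 * expR (- (2 * delta * h ^+ 2))) <= e.
Proof.
move=> d0 e0 h1 hbig lnm; case: m lnm => [|m] lnm; first by rewrite mul0r ltW.
have m0 : 0 < m.+1%:R :> R by rewrite ltr0n.
have mE : m.+1%:R <= expR (delta * h ^+ 2) by rewrite -[leLHS]lnK ?posrE// ler_expR.
apply: (@le_trans _ _ (expR (delta * h ^+ 2) * (2 * expR (- (2 * delta * h ^+ 2))))).
  by rewrite ler_wpM2r// mulr_ge0 ?expR_ge0.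
rewrite mulrCA -expRD (_ : _ + _ = - (delta * h ^+ 2)); last by ring.
rewrite expRN ler_pdivrMr ?expR_gt0//.
apply: (@le_trans _ _ (e * (delta * h))).
  by rewrite mulrA -ler_pdivrMl ?mulr_gt0// mulrC.
rewrite ler_pM2l//; apply: le_trans (_ : delta * h ^+ 2 <= _).
  by rewrite ler_pM2l// expr2 ler_peMl//; lra.
by have := expR_ge1Dx (delta * h ^+ 2); lra.
Qed.

(** Here exp y >= y^2 / 2 is used, since a factor n must be absorbed. *)
Lemma nonzero_union_bound_le q e (k n : nat) : 0 < q -> 0 < e -> (k <= n)%N ->
  4 / (q ^+ 2 * e) <= n%:R -> (0 < n)%N ->
  k%:R * (2 * expR (- (n%:R * q))) <= e.
Proof.
move=> q0 e0 kn nbig n0; have nn0 : 0 < n%:R :> R by rewrite ltr0n.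
apply: (@le_trans _ _ (n%:R * (2 * expR (- (n%:R * q))))).
  by rewrite ler_wpM2r ?ler_nat// mulr_ge0 ?expR_ge0.
rewrite expRN mulrA ler_pdivrMr ?expR_gt0//.
have nq0 : 0 <= n%:R * q by rewrite mulr_ge0 ?(ltW nn0) ?(ltW q0).
have := expR_ge1Dxn 1 nq0; rewrite (_ : 2`!%:R = 2)// => hexp.
apply: (@le_trans _ _ (e * ((n%:R * q) ^+ 2 / 2))); last by rewrite ler_pM2l//; lra.
have qe : 0 < q ^+ 2 * e by rewrite mulr_gt0 ?exprn_gt0.
rewrite ler_pdivrMr// in nbig.
have : 0 <= n%:R * (n%:R * (q ^+ 2 * e) - 4) by rewrite mulr_ge0 ?(ltW nn0)// subr_ge0.
by rewrite exprMn; lra.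
Qed.

End rates.

(** * Selection consistency *)

Theorem theorem3 (R : realType)
  (d : measure_display) (T : measurableType d) (P : probability T R)
  (eps : nat -> {RV P >-> R})
  (k m : nat -> nat)
  (x : forall n, 'M[R]_(n, k n + m n))
  (beta10 : forall n, 'cV[R]_(k n))
  (lambda : nat -> R) (gamma sigma : R)
  (betat : forall n, T -> 'cV[R]_(k n + m n))
  (hx : forall n, (0 < n)%N -> standardized (x n))
  (hbeta10 : forall n, (0 < n)%N -> forall l, beta10 n l 0 != 0)
  (hlambda : forall n, (0 < n)%N -> 0 <= lambda n)
  (hgamma : 0 < gamma < 1)
  (betat_meas : forall n, (0 < n)%N ->
     forall j, measurable_fun [set: T] (fun w => betat n w j 0))
  (betat_min : forall n, (0 < n)%N -> forall w beta,
     let U := bridge_objective (x n)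
       (fun i => response (x n) (beta10 n) eps i w) (lambda n) gamma in
     U (betat n w) <= U beta)
  (eps_indep : mutually_independent eps)
  (eps_ident : identically_distributed eps)
  (eps_mean : forall i, ('E_P[eps i] = 0)%E)
  (hsigma : 0 < sigma ^+ 2)
  (eps_var : forall i, ('V_P[eps i] = (sigma ^+ 2)%:E)%E)
  (eps_subgauss : sub_gaussian eps)
  (partial_orth : exists2 c0 : R, 0 < c0 &
     \forall n \near \oo, forall (j : 'I_(m n)) (l : 'I_(k n)),
       `| (Num.sqrt n%:R)^-1 *
          \sum_i x n i (rshift (k n) j) * x n i (lshift (m n) l) | <= c0)
  (xi_lb : exists2 xi0 : R, 0 < xi0 &
     forall n, (0 < n)%N -> forall l : 'I_(k n),
       xi0 < `| xi (x n) (beta10 n) eps (lshift (m n) l) |)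
  (lambda_small : (fun n => lambda n / n%:R) @ \oo --> (0 : R))
  (lambda_large :
     (fun n => lambda n * n%:R `^ (- gamma / 2) * (k n)%:R `^ (gamma - 2))
       @ \oo --> +oo)
  (log_m : (fun n => ln (m n)%:R : R) =o_\oo
     (fun n => (lambda n * n%:R `^ (- gamma / 2)) `^ (2 / (2 - gamma))))
  (beta10_bounded : exists2 b1 : R, 0 < b1 &
     forall n, (0 < n)%N -> forall l, `| beta10 n l 0 | <= b1) :
  (fun n => P [set w | dsubmx (betat n w) = 0]) @ \oo --> 1%E
  /\
  (fun n => P [set w | forall l, usubmx (betat n w) l 0 != 0]) @ \oo --> 1%E.
Proof.
have [c [c0 eps_int eps_mgf]] := sub_gaussian_mgf eps_mean eps_subgauss.
have [c1 c10 orth] := partial_orth.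
have [b1 b10 bb1] := beta10_bounded.
have [xi0 xi00 xil] := xi_lb.
have g1 : gamma < 1 by case/andP: hgamma.
have g2 : 0 < 2 - gamma by lra.
pose h n := (lambda n * n%:R `^ (- gamma / 2)) `^ (2 - gamma)^-1.
have h_large (D : R) : 0 < D ->
    \forall n \near \oo, [/\ (0 < n)%N, (0 < k n)%N & D * (k n)%:R <= h n].
  move=> D0; have DD : 0 < D `^ (2 - gamma) by exact: powR_gt0.
  near=> n; have n0 : (0 < n)%N by near: n; exact: nbhs_infty_gt.
  have Dn : D `^ (2 - gamma) <=
      lambda n * n%:R `^ (- gamma / 2) * (k n)%:R `^ (gamma - 2).
    by near: n; exact: (cvgryPge _).1 lambda_large _.
  (* the power 0 `^ (gamma - 2) is 0, so the growth condition excludes k n = 0 *)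
  have k0 : (0 < k n)%N.
    rewrite lt0n; apply/eqP => k0; move: Dn; rewrite k0 powR0 ?mulr0; last first.
      by rewrite subr_eq0; apply/eqP; lra.
    by rewrite leNgt DD.
  by split=> //; exact: threshold_ge.
have lamE n : (0 < n)%N -> lambda n = n%:R * (h n / Num.sqrt n%:R) `^ (2 - gamma).
  by move=> n0; apply: lambda_threshold => //; exact: hlambda.
have lam_lt (D : R) : 0 < D -> \forall n \near \oo, lambda n / n%:R < D.
  by move=> D0; exact: cvgr_lt lambda_small _ D0.
have ln_small (D : R) : 0 < D -> \forall n \near \oo, ln (m n)%:R <= D * h n ^+ 2.
  move=> D0; have /eqoP/(_ D D0) := log_m.
  apply: filterS => n; rewrite (_ : 2 / (2 - gamma) = (2 - gamma)^-1 * 2); last by ring.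
  rewrite powRrM powR_mulrn ?powR_ge0// => hn.
  apply: (le_trans (ler_norm _)); apply: (le_trans hn).
  by rewrite ger0_norm// sqr_ge0.
split; apply: cvg_probability1.
- near=> n; apply: probability_le1; apply: measurable_dsubmx_eq0.
  by apply: betat_meas; near: n; exact: nbhs_infty_gt.
- move=> e e0; pose delta := (128 * c)^-1.
  have d0 : 0 < delta by rewrite invr_gt0 mulr_gt0.
  near=> n.
  have [n0 k0 h1] : [/\ (0 < n)%N, (0 < k n)%N & 1 * (k n)%:R <= h n].
    by near: n; exact: h_large.
  have [_ _ h2] : [/\ (0 < n)%N, (0 < k n)%N & 2 / (e * delta) * (k n)%:R <= h n].
    by near: n; apply: h_large; rewrite divr_gt0// mulr_gt0.
  have [_ _ h3] : [/\ (0 < n)%N, (0 < k n)%N & 4 * b1 * c1 * (k n)%:R <= h n].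
    by near: n; apply: h_large; rewrite !mulr_gt0.
  have k1 : 1 <= (k n)%:R :> R by rewrite ler1n.
  have h_ge1 : 1 <= h n by rewrite mul1r in h1; exact: le_trans h1.
  apply: le_trans (probability_zero_part_ge (x := x n) (b := beta10 n) (lambda := lambda n)
    (h := h n) (b1 := b1) (c1 := c1) eps_indep eps_mean eps_int c0 eps_mgf hgamma n0
    _ _ _ _ _ _ _ _).
  + rewrite lee_fin lerD2l lerN2.
    rewrite (_ : h n ^+ 2 / (64 * c) = 2 * delta * h n ^+ 2); last first.
      by rewrite /delta; field; exact: lt0r_neq0.
    apply: zero_union_bound_le => //.
      apply: le_trans h2; rewrite ler_peMr// ltW// divr_gt0// mulr_gt0//.
    by near: n; exact: ln_small.
  + exact: hx.
  + exact: betat_meas.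
  + exact: betat_min.
  + by lra.
  + exact: lamE.
  + by near: n.
  + exact: bb1.
  + by lra.
- near=> n; apply: probability_le1.
  apply: measurable_forall_fin => l; apply: measurable_usubmx_neq0.
  by apply: betat_meas; near: n; exact: nbhs_infty_gt.
- move=> e e0; pose q := xi0 ^+ 2 / (16 * c).
  have q0 : 0 < q by rewrite divr_gt0 ?exprn_gt0// mulr_gt0.
  near=> n.
  have [n0 k0 h1] : [/\ (0 < n)%N, (0 < k n)%N & 1 * (k n)%:R <= h n].
    by near: n; exact: h_large.
  have nn0 : 0 < n%:R :> R by rewrite ltr0n.
  have kn : (k n <= n)%N.
    have : lambda n / n%:R < 1 by near: n; exact: lam_lt.
    (* lambda n < n means h n < sqrt n, and k n <= h n *)
    rewrite lamE// mulrC mulKf ?lt0r_neq0// => hlt.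
    have hn : h n < Num.sqrt n%:R.
      rewrite ltNge; apply/negP => hge; move: hlt; rewrite ltNge => /negP; apply.
      apply: (@le_trans _ _ (1 `^ (2 - gamma))); first by rewrite powR1.
      apply: ge0_ler_powR; rewrite ?nnegrE ?(ltW g2)//.
        by rewrite divr_ge0 ?sqrtr_ge0// powR_ge0.
      by rewrite ler_pdivlMr ?sqrtr_gt0// mul1r.
    rewrite -(ler_nat R) -(@ler_pXn2r _ 2)// ?nnegrE//.
    apply: (@le_trans _ _ n%:R).
      rewrite -[leRHS]sqr_sqrtr ?(ltW nn0)// ler_pXn2r// ?nnegrE ?sqrtr_ge0//.
      by rewrite mul1r in h1; apply: (le_trans h1); exact: ltW.
    by rewrite expr2 ler_peMl ?(ltW nn0)// ler1n.
  apply: le_trans (probability_nonzero_part_ge (x := x n) (b := beta10 n) (lambda := lambda n)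
    (xi0 := xi0) eps_indep eps_mean eps_int c0 eps_mgf hgamma n0
    _ _ _ _ _ _).
  + rewrite lee_fin lerD2l lerN2; apply: nonzero_union_bound_le => //.
    by near: n; exact: nbhs_infty_ger.
  + exact: hx.
  + exact: betat_meas.
  + exact: betat_min.
  + by [].
  + exact: xil.
  + by near: n; apply: lam_lt; rewrite powR_gt0// divr_gt0.
Unshelve. all: by end_near. Qed.
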